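(* There exists a universal constant $c>0$ such that the following two statements hold. (1) For every reversible, irreducible Markov chain on a finite state space $\Omega$ with at least two states, with transition matrix $P$ satisfying $P_{xx}\ge 1/2$ for all $x\in\Omega$, $$\frac{t_{\rm mix}^P}{c}\le T^P(1/2)\le c\,t_{\rm mix}^P.$$ (2) For every irreducible Markov chain on a finite state space with at least two states, with transition matrix $P$ (not necessarily reversible or lazy), $$\frac{t_{\rm Ces}^P}{c}\le T^P(1/2)\le c\,t_{\rm Ces}^P.$$
   Context: Let $X=(X_t)_{t\ge 0}$ be an irreducible discrete-time Markov chain with finite state space $\Omega$, transition matrix $P$ and stationary distribution $\pi$. The hitting time of $A\subseteq\Omega$ is $\tau_A=\min\{t\ge 0: X_t\in A\}$, and $\mathbb{E}_x$ denotes expectation for the chain started at $X_0=x$. For $\gamma\in(0,1)$, $$T^P(\gamma)=\max\{\mathbb{E}_x[\tau_A] : x\in\Omega,\ A\subseteq\Omega,\ \pi(A)\ge\gamma\}.$$ Write $P^t(x,A)=\sum_{y\in A}P^t(x,y)$. The mixing time is $$t_{\rm mix}^P=\min\left\{t\in\mathbb{N} : \forall x\in\Omega,\ \forall A\subset\Omega,\ |P^t(x,A)-\pi(A)|\le\tfrac14\right\},$$ and the Cesàro mixing time is $$t_{\rm Ces}^P=\min\left\{t\in\mathbb{N} : \forall x\in\Omega,\ \forall A\subset\Omega,\ \left|\frac1t\sum_{s=0}^{t-1}P^s(x,A)-\pi(A)\right|\le\tfrac14\right\},$$ where $\mathbb{N}=\{1,2,3,\dots\}$. *)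

(* Defs.v *)
From HB Require Import structures.
From mathcomp Require Import all_boot all_order all_algebra.
From mathcomp Require Import all_classical all_reals all_analysis.

Set Implicit Arguments.
Unset Strict Implicit.
Unset Printing Implicit Defensive.

Import Order.TTheory GRing.Theory Num.Theory.
Import numFieldNormedType.Exports.

Local Open Scope classical_set_scope.
Local Open Scope ring_scope.

Definition transition_matrix (R : realType) (Omega : finType)
    (P : Omega -> Omega -> R) : Prop :=
  (forall x y, 0 <= P x y) /\ (forall x, \sum_y P x y = 1).

Fixpoint matpow (R : realType) (Omega : finType) (P : Omega -> Omega -> R)
    (t : nat) (x y : Omega) : R :=
  if t is s.+1 then \sum_z P x z * matpow P s z y else (x == y)%:R.

Definition mass (R : realType) (Omega : finType) (f : Omega -> R)
    (A : {set Omega}) : R := \sum_(y in A) f y.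

Definition irreducible_chain (R : realType) (Omega : finType)
    (P : Omega -> Omega -> R) : Prop :=
  forall x y, exists t, 0 < matpow P t x y.

Definition stationary_distribution (R : realType) (Omega : finType)
    (P : Omega -> Omega -> R) (pi : Omega -> R) : Prop :=
  [/\ forall x, 0 <= pi x,
      \sum_x pi x = 1
    & forall y, \sum_x pi x * P x y = pi y].

Definition reversible_chain (R : realType) (Omega : finType)
    (P : Omega -> Omega -> R) (pi : Omega -> R) : Prop :=
  forall x y, pi x * P x y = pi y * P y x.

(* [X] is the trajectory and [Pr x] the law under which it starts at [x].     *)
(* The Markov property is stated multiplicatively, so that it needs no        *)
(* conditioning on possibly null events.                                      *)
Definition markov_chain (R : realType) (Omega : finType)
    (P : Omega -> Omega -> R) (d : measure_display) (T : measurableType d)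
    (Pr : Omega -> probability T R) (X : nat -> T -> Omega) : Prop :=
  [/\ forall t y, measurable [set u | X t u = y],
      forall x, Pr x [set u | X 0%N u = x] = 1%E
    & forall (x : Omega) (t : nat) (w : nat -> Omega),
        Pr x [set u | forall s, (s <= t.+1)%N -> X s u = w s] =
        (Pr x [set u | forall s, (s <= t)%N -> X s u = w s] *
         (P (w t) (w t.+1))%:E)%E].

(* The infimum of the empty set is [+oo]: this is the value of the hitting    *)
(* time on trajectories that never visit [A].                                 *)
Definition hitting_time (R : realType) (Omega : finType) (U : Type)
    (X : nat -> U -> Omega) (A : {set Omega}) (u : U) : \bar R :=
  ereal_inf [set (t%:R)%:E | t in [set t : nat | X t u \in A]].

Definition expected_hitting_time (R : realType) (Omega : finType)
    (d : measure_display) (T : measurableType d)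
    (Pr : Omega -> probability T R) (X : nat -> T -> Omega)
    (x : Omega) (A : {set Omega}) : \bar R :=
  (\int[Pr x]_u hitting_time R X A u)%E.

Definition max_hitting_time (R : realType) (Omega : finType)
    (d : measure_display) (T : measurableType d)
    (Pr : Omega -> probability T R) (X : nat -> T -> Omega)
    (pi : Omega -> R) (gamma : R) : \bar R :=
  \big[Order.max/-oo%E]_(xA : Omega * {set Omega} | gamma <= mass pi xA.2)
    expected_hitting_time Pr X xA.1 xA.2.

(* The junk value for an empty set is 0, which is never a mixing time, as     *)
(* those range over positive integers.                                        *)
Definition nat_min (S : set nat) : nat :=
  xget 0%N [set t | S t /\ forall s, S s -> (t <= s)%N].

Definition mixing_time (R : realType) (Omega : finType)
    (P : Omega -> Omega -> R) (pi : Omega -> R) : nat :=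
  nat_min [set t | (0 < t)%N /\
    forall (x : Omega) (A : {set Omega}),
      `|mass (matpow P t x) A - mass pi A| <= 4^-1].

Definition cesaro_mixing_time (R : realType) (Omega : finType)
    (P : Omega -> Omega -> R) (pi : Omega -> R) : nat :=
  nat_min [set t | (0 < t)%N /\
    forall (x : Omega) (A : {set Omega}),
      `|t%:R^-1 * (\sum_(s < t) mass (matpow P s x) A) - mass pi A| <= 4^-1].

(* Main.v *)
Require Import Defs.
From HB Require Import structures.
From mathcomp Require Import all_boot all_order all_algebra.
From mathcomp Require Import all_classical all_reals all_analysis.
From mathcomp Require Import measurable_realfun ring lra.

Set Implicit Arguments.
Unset Strict Implicit.
Unset Printing Implicit Defensive.

Import Order.TTheory GRing.Theory Num.Theory.
Import numFieldNormedType.Exports.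

Local Open Scope ring_scope.

(** Write [H] for the maximal expected hitting time of sets of stationary
    mass at least [1/2], and [Pf] for the function [x |-> E_x f(X_1)].

    Bounding [H] from above is the easy direction.  At a mixing time [t], a set
    [A] with [pi(A) >= 1/2] has [P^t(x,A) >= 1/4] for every [x], so each block
    of about [t] steps hits [A] with probability at least [1/4], and
    [E_x tau_A <= 4(t+1)]; an average over times below [t] does as well
    ([hitting_bound_mixing], [hitting_bound_cesaro]).

    The Cesàro bound rests on one observation ([potential_bound]).  Suppose
    that [F] has [pi]-mean zero and that [|F - PF| <= 1].  Along the chain [F]
    then drifts by at most one per step in expectation, so a lower bound for
    [F] on a set of mass at least [1/2] holds everywhere up to a loss of [H].
    Up to sign, [F >= 0] on half of the space, whence [F >= -H] everywhere.
    Then [F + H] is nonnegative with mean [H], so [F <= H] on half of the space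
    by Markov's inequality, and the same argument for [-F] gives [F <= 2H]
    everywhere.  Applied to the ergodic sum [F = sum_(s<t) P^s f] of
    [f = 1_A - pi(A)], for which [F - PF = f - P^t f], this bounds all ergodic
    sums by [2H] whatever their length.  Dividing by [t >= 8H] gives the error
    [1/4] in the definition of the Cesàro mixing time.

    For a lazy reversible chain, the autocorrelations [c_j = <f, P^j f>] in
    [L^2(pi)] form a nonnegative, nonincreasing, convex sequence: laziness
    makes [P] positive semidefinite.  Their partial sums are scalar products of
    [f] with ergodic sums, hence at most [2H]; therefore [c_j <= 2H/j] and
    [c_j - c_{j+1} <= 1/j].  At a time [t] that is a large multiple of [H],
    [P^t f] is thus small in [L^2(pi)], and so are its increments: over a window
    of [N], about [8H], further steps, the supremum of [|P^(t+n) f|] is at most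
    [1/8] on a set [G] of mass at least [1/2] ([mixing_close]).  From any state,
    the chain hits [G] within [N] steps except with probability at most
    [H/N <= 1/8], and the Markov property at that time gives
    [|P^(t+N) f| <= 1/8 + 1/8].

    Hitting times enter these arguments only through the truncated expectations
    [E_x min(tau_A, n)], which satisfy a finite recursion.  The Markov property
    of the trajectory and the tail-sum formula identify their supremum with the
    expected hitting time ([expected_hitting_time_tail_sum]). *)

(** * The transition operator and stationary masses *)

Section TransitionOperator.
Context {R : realType} {Omega : finType}.
Implicit Types (P : Omega -> Omega -> R) (f g pi : Omega -> R).
Implicit Types (A B : {set Omega}) (x y : Omega).

Definition avg P f x : R := \sum_y P x y * f y.

Definition ind A x : R := (x \in A)%:R.

Lemma mass_ind f A : mass f A = \sum_x f x * ind A x.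
Proof.
rewrite /mass big_mkcond; apply: eq_bigr => x _.
by rewrite /ind; case: (x \in A); rewrite ?mulr1 ?mulr0.
Qed.

Lemma mass_matpow P t x A :
  mass (matpow P t x) A = iter t (avg P) (ind A) x.
Proof.
elim: t x => [|t IH] x /=.
  rewrite mass_ind (bigD1 x) //= eqxx mul1r big1 ?addr0 // => y yx.
  by rewrite eq_sym (negbTE yx) mul0r.
rewrite mass_ind /avg.
under eq_bigr do rewrite big_distrl /=.
rewrite exchange_big /=; apply: eq_bigr => z _.
rewrite -IH mass_ind big_distrr /=.
by apply: eq_bigr => y _; rewrite mulrA.
Qed.

Lemma mass_le_setC pi A a : \sum_x pi x = 1 -> mass pi A <= a ->
  1 - a <= mass pi (~: A).
Proof.
move=> pi1; suff : mass pi A + mass pi (~: A) = 1 by move=> *; lra.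
rewrite -pi1 !mass_ind -big_split /=; apply: eq_bigr => x _.
by rewrite /ind inE; case: (x \in A); rewrite /= ?mulr1 ?mulr0 ?addr0 ?add0r.
Qed.

Lemma mass_sub pi A B : (forall x, 0 <= pi x) -> A \subset B ->
  mass pi A <= mass pi B.
Proof.
move=> pi0 /fintype.subsetP AB; rewrite !mass_ind; apply: ler_sum => x _.
apply: ler_wpM2l => //; rewrite /ind ler_nat.
by case: (boolP (x \in A)) => // /AB ->.
Qed.

(** Markov's inequality for the stationary mass of a superlevel set. *)
Lemma mass_sublevel pi f a : (forall x, 0 <= pi x) -> \sum_x pi x = 1 ->
  (forall x, 0 <= f x) -> 0 < a -> \sum_x pi x * f x <= a / 2 ->
  2^-1 <= mass pi [set x | f x <= a].
Proof.
move=> pi0 pi1 f0 a0 fa; set B := [set x | _].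
have -> : 2^-1 = 1 - 2^-1 :> R by lra.
rewrite -[B]finset.setCK; apply: mass_le_setC => //.
have : mass pi (~: B) * a <= \sum_x pi x * f x.
  rewrite mass_ind big_distrl /=; apply: ler_sum => x _.
  rewrite -mulrA ler_wpM2l // /ind !inE -ltNge.
  by case: ltP => xa; rewrite /= ?mul1r ?mul0r // ltW.
by move=> h; rewrite -(ler_pM2r a0); lra.
Qed.

Lemma avgD P f g x : avg P (fun y => f y + g y) x = avg P f x + avg P g x.
Proof. by rewrite -big_split; apply: eq_bigr => y _; rewrite mulrDr. Qed.

Lemma avgZ P a f x : avg P (fun y => a * f y) x = a * avg P f x.
Proof. by rewrite big_distrr; apply: eq_bigr => y _; rewrite mulrCA. Qed.

Lemma avgB P f g x : avg P (fun y => f y - g y) x = avg P f x - avg P g x.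
Proof. by rewrite -sumrB; apply: eq_bigr => y _; rewrite mulrBr. Qed.

Lemma avgN P f x : avg P (fun y => - f y) x = - avg P f x.
Proof. by rewrite -sumrN; apply: eq_bigr => y _; rewrite mulrN. Qed.

Lemma avg_sum P n (F : nat -> Omega -> R) x :
  avg P (fun y => \sum_(i < n) F i y) x = \sum_(i < n) avg P (F i) x.
Proof.
rewrite exchange_big /=; apply: eq_bigr => y _.
by rewrite big_distrr.
Qed.

Lemma avg_cst P a x : transition_matrix P -> avg P (fun=> a) x = a.
Proof. by case=> _ P1; rewrite /avg -big_distrl /= P1 mul1r. Qed.

Lemma avg_le P f g x : transition_matrix P ->
  (forall y, f y <= g y) -> avg P f x <= avg P g x.
Proof. by case=> P0 _ fg; apply: ler_sum => y _; apply: ler_wpM2l. Qed.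

Lemma avg_norm_le P f a x : transition_matrix P ->
  (forall y, `|f y| <= a) -> `|avg P f x| <= a.
Proof.
move=> tP fa; have tm := @avg_le P _ _ x tP.
rewrite ler_norml -{1}(avg_cst (- a) x tP) -{2}(avg_cst a x tP).
by apply/andP; split; apply: tm => y; have := fa y;
  rewrite ler_norml => /andP[].
Qed.

Lemma iter_avg_norm_le P t f a x : transition_matrix P ->
  (forall y, `|f y| <= a) -> `|iter t (avg P) f x| <= a.
Proof.
move=> tP fa; elim: t x => [|t IH] x //.
exact: avg_norm_le.
Qed.

Lemma iter_avgBcst P t f a x : transition_matrix P ->
  iter t (avg P) (fun y => f y - a) x = iter t (avg P) f x - a.
Proof.
move=> tP; elim: t x => [|t IH] x //=.
by rewrite (funext IH) avgB avg_cst.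
Qed.

Lemma avg_stationary P pi f : stationary_distribution P pi ->
  \sum_x pi x * avg P f x = \sum_x pi x * f x.
Proof.
case=> _ _ st; under eq_bigr do rewrite /avg big_distrr /=.
rewrite exchange_big; apply: eq_bigr => y _.
by rewrite -st big_distrl; apply: eq_bigr => x _; rewrite /= mulrA.
Qed.

Lemma iter_avg_stationary P pi t f : stationary_distribution P pi ->
  \sum_x pi x * iter t (avg P) f x = \sum_x pi x * f x.
Proof.
move=> st; elim: t => //= t IH.
by rewrite avg_stationary.
Qed.

End TransitionOperator.

(** * Truncated hitting times *)

Section TruncatedHitting.
Context {R : realType} {Omega : finType}.
Variables (P : Omega -> Omega -> R).
Hypothesis tP : transition_matrix P.
Implicit Types (A B : {set Omega}) (x y : Omega).

(** This is [P_x(tau_A >= n)]: by the Markov property at time one, a chain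
    outside [A] has to avoid [A] for [n - 1] steps from its next state. *)
Fixpoint survival A n x : R :=
  if n is m.+1 then if x \in A then 0 else avg P (survival A m) x else 1.

(** This is [E_x (min(tau_A, n))], by first-step analysis. *)
Fixpoint truncated_hit A n x : R :=
  if n is m.+1 then
    if x \in A then 0 else 1 + avg P (truncated_hit A m) x
  else 0.

Lemma survivalE A n x : survival A n.+1 x =
  if x \in A then 0 else avg P (survival A n) x.
Proof. by []. Qed.

Lemma truncated_hitE A n x : truncated_hit A n.+1 x =
  if x \in A then 0 else 1 + avg P (truncated_hit A n) x.
Proof. by []. Qed.

Lemma survival_ge0 A n x : 0 <= survival A n x.
Proof.
elim: n x => [|n IH] x //=; case: ifP => // _.
by rewrite -[leLHS](avg_cst 0 x tP); apply: avg_le.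
Qed.

Lemma survivalS_le A n x : survival A n.+1 x <= survival A n x.
Proof.
elim: n x => [|n IH] x /=; case: ifP => // _.
  by rewrite avg_cst.
exact: avg_le.
Qed.

Lemma survival_le A m n x : (m <= n)%N -> survival A n x <= survival A m x.
Proof.
move=> /subnK <-; elim: (n - m)%N => //= k IH.
exact: le_trans (survivalS_le A (k + m) x) IH.
Qed.

Lemma truncated_hitS A n x :
  truncated_hit A n.+1 x = truncated_hit A n x + survival A n.+1 x.
Proof.
elim: n x => [|n IH] x.
  rewrite /=; case: ifP => _; first by rewrite addr0.
  by rewrite add0r !avg_cst // addr0.
rewrite !truncated_hitE survivalE; case: ifP => _; first by rewrite addr0.
by rewrite -addrA -avgD; congr (_ + avg P _ x); apply/funext.
Qed.

Lemma truncated_hit_sum A n x :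
  truncated_hit A n x = \sum_(i < n) survival A i.+1 x.
Proof.
by elim: n => [|n IH]; rewrite ?big_ord0 // big_ord_recr -IH truncated_hitS.
Qed.

Lemma truncated_hit_ge0 A n x : 0 <= truncated_hit A n x.
Proof.
by rewrite truncated_hit_sum sumr_ge0 // => i _; exact: survival_ge0.
Qed.

(** Markov's inequality for [min(tau_A, n)]. *)
Lemma survival_markov A n x : n%:R * survival A n x <= truncated_hit A n x.
Proof.
rewrite truncated_hit_sum mulr_natl -[X in _ *+ X]card_ord -sumr_const.
by apply: ler_sum => i _; apply: survival_le.
Qed.

(** Markov property at time [t]: a chain that has not hit [A] by then, which
    has probability [survival A t x], needs at most [M] more steps on
    average. *)
Lemma truncated_hit_restart A m t M x : 0 <= M ->
  (forall y, truncated_hit A m y <= M) ->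
  truncated_hit A (t + m) x <= t%:R + M * survival A t x.
Proof.
move=> M0 hM; elim: t x => [|t IH] x; first by rewrite mulr1 add0r.
rewrite /=; case: ifP => _; first by rewrite mulr0 addr0.
have := avg_le x tP IH; rewrite avgD avg_cst // avgZ -natr1; lra.
Qed.

Lemma truncated_hit_homo A m n x : (m <= n)%N ->
  truncated_hit A m x <= truncated_hit A n x.
Proof.
move=> /subnK <-; elim: (n - m)%N => // k IH.
apply: le_trans IH _; rewrite addSn truncated_hitS lerDl; exact: survival_ge0.
Qed.

Lemma ex_maximizer (f : Omega -> R) (x0 : Omega) :
  exists x, forall y, f y <= f x.
Proof.
by case: (@arg_maxP _ R _ x0 xpredT f isT) => x _ fx; exists x => y; apply: fx.
Qed.

(** If every block of [t] steps hits [A] with probability at least [e], the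
    number of blocks is dominated by a geometric variable of mean [1/e].  In
    terms of the largest value [M] of the truncated expectation, restarting
    after one block gives [M <= t + (1 - e) M]. *)
Lemma truncated_hit_bounded A t e x : 0 < e ->
  (forall y, survival A t y <= 1 - e) ->
  forall m, truncated_hit A m x <= t%:R / e.
Proof.
move=> e0 he m; have [z zmax] := ex_maximizer (truncated_hit A m) x.
apply: le_trans (zmax x) _; rewrite ler_pdivlMr //.
have h0 := truncated_hit_ge0 A m z.
have := truncated_hit_restart t z h0 zmax.
have := truncated_hit_homo A z (leq_addl t m).
have := ler_wpM2l h0 (he z); lra.
Qed.

(** A chain that sits in [A] at time [s] has hit [A] by time [s]. *)
Lemma survival_le_avoid A s x :
  survival A s.+1 x <= 1 - iter s (avg P) (ind A) x.
Proof.
elim: s x => [|s IH] x.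
  by rewrite /= /ind; case: ifP => _; rewrite /= ?subrr ?subr0 ?avg_cst.
have : iter s.+1 (avg P) (ind A) x <= 1.
  apply: le_trans (ler_norm _) _.
  apply: iter_avg_norm_le => // y.
  by rewrite /ind; case: (y \in A); rewrite ?normr0 ?normr1.
rewrite [survival _ _ _]/=; case: ifP => _; first by lra.
by move=> _; have := avg_le x tP IH; rewrite avgB avg_cst.
Qed.

(** Optional stopping at [min(tau_A, n)]: in expectation [G] loses at most one
    per step before [A] is hit; at the stopping time it is nonnegative if the
    chain is in [A], and at least [-C] otherwise. *)
Lemma hit_lower A G C n x : 0 <= C ->
  (forall y, y \in A -> 0 <= G y) -> (forall y, - C <= G y) ->
  (forall y, avg P G y - 1 <= G y) ->
  - truncated_hit A n x - C * survival A n x <= G x.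
Proof.
move=> C0 GA GC GP; elim: n x => [|n IH] x.
  by rewrite /= oppr0 mulr1 add0r.
rewrite /=; case: ifP => [xA|_]; first by rewrite oppr0 mulr0 subr0 GA.
apply: le_trans (GP x); have := avg_le x tP IH.
rewrite avgB avgZ avgN; lra.
Qed.

(** Let [n] tend to infinity in [hit_lower]: [survival A n x] is at most
    [H / n], so the contribution of the unstopped trajectories vanishes. *)
Lemma hit_lower_bound A H G x :
  (forall n y, truncated_hit A n y <= H) ->
  (forall y, y \in A -> 0 <= G y) ->
  (forall y, avg P G y - 1 <= G y) -> - H <= G x.
Proof.
move=> hH GA GP.
pose C := \sum_y `|G y|.
have C0 : 0 <= C by rewrite sumr_ge0.
have GC y : - C <= G y.
  have : `|G y| <= C by rewrite /C (bigD1 y) //= lerDl sumr_ge0.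
  by rewrite ler_norml => /andP[].
have H0 : 0 <= H by have := hH 0%N x.
apply/ler_addgt0Pr => e e0.
set n := (Num.bound (C * H / e)).
have CHe : 0 <= C * H / e by rewrite divr_ge0 ?mulr_ge0 // ltW.
have CHn : C * H / e < n%:R by exact: archi_boundP.
have n0 : 0 < n%:R :> R by exact: le_lt_trans CHn.
have := hit_lower n x C0 GA GC GP.
suff : C * survival A n x <= e by have := hH n x; lra.
rewrite -(ler_pM2l n0) mulrCA.
rewrite ltr_pdivrMr // in CHn; apply: le_trans (ltW CHn).
by apply: ler_wpM2l => //; apply: le_trans (survival_markov A n x) _.
Qed.

End TruncatedHitting.

(** * Hitting times of the trajectory *)

Section ChainPaths.
Local Open Scope classical_set_scope.
Local Open Scope ereal_scope.
Context {R : realType} {Omega : finType}.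
Context {d : measure_display} {T : measurableType d}.
Variables (P : Omega -> Omega -> R).
Variables (Pr : Omega -> probability T R) (X : nat -> T -> Omega).
Hypothesis tP : transition_matrix P.
Hypothesis mc : markov_chain P Pr X.
Implicit Types (A : {set Omega}) (x y : Omega) (w : nat -> Omega).

Lemma measurable_state t (B : set Omega) : measurable [set u | B (X t u)].
Proof.
have [mX _ _] := mc.
rewrite (_ : [set u | _] = \bigcup_(y in B) [set u | X t u = y]).
  by apply: fin_bigcup_measurable => // ? _; exact: mX.
by apply/seteqP; split => [u Bu|u [y By /= ->]] //; exists (X t u).
Qed.

Lemma measure_partition (mu : {measure set T -> \bar R}) t (E : set T) :
  measurable E -> mu E = \sum_y mu (E `&` [set u | X t u = y]).
Proof.
move=> mE; rewrite [RHS]fsbig_seq ?index_enum_uniq //.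
rewrite (_ : [set` index_enum Omega] = setT); last first.
  by apply/seteqP; split => y // _ /=; rewrite mem_index_enum.
rewrite -measure_fin_bigcup //.
- by congr (mu _); apply/seteqP; split => [u Eu|u [y _ []]//]; exists (X t u).
- exact: finite_finset.
- by move=> y z _ _ [u [[_ <-] [_ <-]]].
- by move=> y _; apply: measurableI => //; exact: (measurable_state t [set y]).
Qed.

Definition cylinder w t : set T :=
  [set u | forall s, (s <= t)%N -> X s u = w s].

Definition avoids A t n : set T :=
  [set u | forall s, (t <= s <= t + n)%N -> X s u \notin A].

Lemma measurable_forall_state t n (B : nat -> set Omega) :
  measurable [set u | forall s, (t <= s <= n)%N -> B s (X s u)].
Proof.
rewrite (_ : [set u | _] =
  \bigcap_(s in [set s | (t <= s <= n)%N]) [set u | B s (X s u)]).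
  by apply: fin_bigcap_measurable => [|s _];
    [apply: (sub_finite_set _ (finite_II n.+1)) => s /andP[]
    | exact: measurable_state].
by apply/seteqP; split => u h s; exact: h.
Qed.

Lemma measurable_cylinder w t : measurable (cylinder w t).
Proof. exact: (measurable_forall_state 0 t (fun s => [set w s])). Qed.

Lemma measurable_avoids A t n : measurable (avoids A t n).
Proof.
exact: (measurable_forall_state t (t + n) (fun=> [set y | y \notin A])).
Qed.

(** The Markov property is given for cylinders only.  Refining a cylinder by
    the value of the next state matches the first-step recursion of
    [survival], which extends it to events that avoid [A]. *)
Lemma cylinder_avoids x w A t n :
  Pr x (cylinder w t `&` avoids A t n) =
  Pr x (cylinder w t) * (survival P A n.+1 (w t))%:E.
Proof.
elim: n t w => [|n IH] t w; rewrite survivalE; case: ifPn => wA.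
- rewrite mule0 (_ : _ `&` _ = set0) ?measure0 //.
  rewrite -subset0 => u [wu /(_ t)].
  by rewrite leqnn leq_addr wu // wA => /(_ isT).
- rewrite avg_cst // mule1; congr (Pr x _); apply/seteqP; split => u.
    by case.
  move=> wu; split => // s; rewrite addn0 -eqn_leq => /eqP <-.
  by rewrite wu.
- rewrite mule0 (_ : _ `&` _ = set0) ?measure0 //.
  rewrite -subset0 => u [wu /(_ t)].
  by rewrite leqnn leq_addr wu // wA => /(_ isT).
rewrite (measure_partition _ t.+1); last first.
  apply: measurableI; first exact: measurable_cylinder.
  exact: measurable_avoids.
rewrite /avg -sumEFin ge0_sume_distrr; last first.
  by move=> y _; rewrite lee_fin mulr_ge0 ?(proj1 tP) // survival_ge0.
apply: eq_bigr => y _.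
pose w' s := if s == t.+1 then y else w s.
have w't : w' t = w t by rewrite /w' ltn_eqF.
have ww' : cylinder w' t = cylinder w t.
  by apply/seteqP; split => u h s st; rewrite h // /w' ltn_eqF.
have [_ _ step] := mc.
rewrite EFinM muleA -{1}w't -ww'.
have -> : P (w' t) y = P (w' t) (w' t.+1) by rewrite /w' eqxx.
rewrite -/(cylinder w' t) -[X in X * _]step.
rewrite -[y in survival _ _ _ y](_ : w' t.+1 = y);
  last by rewrite /w' eqxx.
rewrite -IH; congr (Pr x _); apply/seteqP; split => u.
  move=> [[wu Au] Xy]; split=> s.
    rewrite leq_eqVlt => /orP[/eqP ->|]; first by rewrite /w' eqxx.
    by rewrite ltnS => st; rewrite wu // /w' ltn_eqF.
  by move=> /andP[ts sn]; apply: Au; rewrite ltnW //= addnS -addSn.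
move=> [wu Au]; split; last by rewrite /= wu // /w' eqxx.
split=> s.
  by move=> st; rewrite wu ?leqW // /w' ltn_eqF.
move=> /andP[]; rewrite leq_eqVlt => /orP[/eqP <- _|ts sn].
  by rewrite wu // w't.
by apply: Au; rewrite ts addSn -addnS.
Qed.

(** The law [Pr x] is carried by the cylinder of trajectories starting at
    [x], so [cylinder_avoids] at time 0 can drop the cylinder. *)
Lemma prob_avoids x A n : Pr x (avoids A 0 n) = (survival P A n.+1 x)%:E.
Proof.
have [mX Pr0 _] := mc.
have P1 : Pr x (cylinder (fun=> x) 0) = 1.
  rewrite -[RHS](Pr0 x); congr (Pr x _); apply/seteqP.
  split => u /=; first exact.
  by move=> u0 s; rewrite leqn0 => /eqP ->.
have := cylinder_avoids x (fun=> x) A 0 n; rewrite P1 mul1e => <-.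
have mc0 := measurable_cylinder (fun=> x) 0.
have mA := measurable_avoids A 0 n.
have PC0 : Pr x (~` cylinder (fun=> x) 0) = 0.
  by rewrite probability_setC // P1 subee.
have AC0 : Pr x (avoids A 0 n `\` cylinder (fun=> x) 0) = 0.
  apply/eqP; rewrite -measure_le0 -PC0; apply: le_measure; rewrite ?inE //.
  - exact: measurableD.
  - exact: measurableC.
transitivity (Pr x (avoids A 0 n `\` cylinder (fun=> x) 0) +
              Pr x (avoids A 0 n `&` cylinder (fun=> x) 0)).
  exact: measureDI.
by rewrite AC0 add0e setIC.
Qed.

(** The event [tau_A > n] is that [A] is avoided up to time [n] included; both
    sides are infinite on trajectories that never visit [A]. *)
Lemma hitting_time_tail_sum A u :
  hitting_time R X A u = \sum_(n <oo) (\1_(avoids A 0 n) u)%:E.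
Proof.
have ind0 n : 0 <= (\1_(avoids A 0 n) u)%:E :> \bar R by rewrite lee_fin.
have [[t0 t0A]|noA] := pselect (exists t, X t u \in A).
  have ex_hit : exists t, X t u \in A by exists t0.
  case: (ex_minnP ex_hit) => k kA kmin.
  have indE n : \1_(avoids A 0 n) u = (n < k)%:R :> R.
    rewrite indicE; congr (_%:R); congr nat_of_bool; apply/idP/idP.
      rewrite inE => /(_ k); rewrite leq0n add0n ltnNge => h.
      by apply/negP => kn; have := h kn; rewrite kA.
    move=> nk; rewrite inE => s /=; rewrite add0n => sn.
    by apply/negP => /kmin; rewrite leqNgt (leq_ltn_trans sn nk).
  have -> : hitting_time R X A u = k%:R%:E.
    apply/eqP; rewrite eq_le; apply/andP; split.
      by apply: ereal_inf_lbound; exists k.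
    apply: le_ereal_inf_tmp => _ [t tA <-].
    by rewrite lee_fin ler_nat kmin.
  rewrite (nneseries_split 0 k) // add0n eseries0; last first.
    by move=> i ki _; rewrite indE ltnNge ki.
  rewrite adde0 sumEFin big_mkord (eq_bigr (fun=> 1%R)).
    by rewrite sumr_const card_ord.
  by move=> i _; rewrite indE ltn_ord.
have -> : hitting_time R X A u = +oo.
  rewrite /hitting_time (_ : [set t | X t u \in A] = set0).
    by rewrite image_set0 ereal_inf0.
  by rewrite -subset0 => t tA; apply: noA; exists t.
apply/esym/eqyP => M M0.
apply: le_trans (nneseries_lim_ge (Num.bound M) _);
  last by move=> n _ _; exact: ind0.
rewrite sumEFin lee_fin big_mkord (eq_bigr (fun=> 1%R)).
  by rewrite sumr_const card_ord; apply/ltW/archi_boundP/ltW.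
move=> i _; rewrite indicE mem_set // => s _.
by apply/negP => sA; apply: noA; exists s.
Qed.

Lemma expected_hitting_time_tail_sum x A :
  expected_hitting_time Pr X x A =
  \sum_(n <oo) (survival P A n.+1 x)%:E.
Proof.
rewrite /expected_hitting_time.
under eq_integral do rewrite hitting_time_tail_sum.
rewrite integral_nneseries //.
- apply: congr_lim; apply/funext => n; apply: eq_bigr => i _.
  rewrite integral_indic ?setIT; [|by []|exact: measurable_avoids].
  exact: prob_avoids.
- move=> n; apply/measurable_EFinP.
  by apply: measurable_indic; exact: measurable_avoids.
Qed.

Lemma truncated_hit_le_expected x A n :
  (truncated_hit P A n x)%:E <= expected_hitting_time Pr X x A.
Proof.
rewrite expected_hitting_time_tail_sum truncated_hit_sum // -sumEFin.
rewrite -(big_mkord xpredT (fun i => (survival P A i.+1 x)%:E)).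
by apply: nneseries_lim_ge => i _ _; rewrite lee_fin survival_ge0.
Qed.

Lemma expected_le_truncated_hit x A (M : R) :
  (forall n, (truncated_hit P A n x <= M)%R) ->
  expected_hitting_time Pr X x A <= M%:E.
Proof.
move=> hM; rewrite expected_hitting_time_tail_sum.
apply: lime_le.
  by apply: is_cvg_nneseries => i _ _; rewrite lee_fin survival_ge0.
apply: nearW => n; rewrite sumEFin lee_fin big_mkord.
by rewrite -truncated_hit_sum.
Qed.

End ChainPaths.

(** * Ergodic sums are bounded by the hitting time *)

Section ErgodicSums.
Context {R : realType} {Omega : finType}.
Variables (P : Omega -> Omega -> R) (pi : Omega -> R).
Hypotheses (tP : transition_matrix P) (st : stationary_distribution P pi).
Implicit Types (A : {set Omega}) (f F G : Omega -> R) (x y : Omega).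

Definition hitting_bound (H : R) : Prop :=
  forall A, 2^-1 <= mass pi A -> forall n x, truncated_hit P A n x <= H.

(** The set where [F >= 0] gives the lower bound [-H].  With it, [F + H] is
    nonnegative of mean [H], so [F <= H] has mass at least [1/2]; hitting that
    set from anywhere gives the upper bound. *)
Lemma potential_bound_half H F : 0 < H -> hitting_bound H ->
  \sum_x pi x * F x = 0 -> (forall x, `|F x - avg P F x| <= 1) ->
  2^-1 <= mass pi [set x | 0 <= F x] -> forall x, `|F x| <= 2 * H.
Proof.
move=> H0 hH F0 FP hF x; have [pi0 pi1 _] := st.
have lowF y : - H <= F y.
  apply: (hit_lower_bound tP y (hH _ hF)) => z; first by rewrite inE.
  by have := FP z; rewrite ler_norml => /andP[*]; lra.
pose B := [set y | F y + H <= 2 * H].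
have hB : 2^-1 <= mass pi B.
  apply: mass_sublevel => // [y||]; [by have := lowF y; lra|by lra|].
  under eq_bigr do rewrite mulrDr.
  by rewrite big_split /= F0 add0r -big_distrl /= pi1 mul1r; lra.
have upF : - H <= H - F x.
  apply: (hit_lower_bound (G := fun y => H - F y) tP x (hH _ hB)) => z.
    by rewrite inE => ?; lra.
  by rewrite avgB avg_cst //; have := FP z; rewrite ler_norml => /andP[*]; lra.
by rewrite ler_norml; have := lowF x; move=> *; apply/andP; split; lra.
Qed.

Lemma potential_bound H F : 0 < H -> hitting_bound H ->
  \sum_x pi x * F x = 0 -> (forall x, `|F x - avg P F x| <= 1) ->
  forall x, `|F x| <= 2 * H.
Proof.
move=> H0 hH F0 FP; have [pi0 pi1 _] := st.
have [hF|hF] := leP 2^-1 (mass pi [set x | 0 <= F x]).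
  exact: potential_bound_half.
move=> x; rewrite -normrN.
apply: (potential_bound_half (F := fun x => - F x) H0 hH).
- by under eq_bigr do rewrite mulrN; rewrite sumrN F0 oppr0.
- by move=> y; rewrite avgN -opprD normrN.
- have := mass_le_setC pi1 (ltW hF).
  have -> : 1 - 2^-1 = 2^-1 :> R by lra.
  move=> h; apply: le_trans h _; apply: mass_sub => //.
  by apply/fintype.subsetP => y; rewrite !inE -ltNge oppr_ge0 => /ltW.
Qed.

(** The bound does not grow with [t], because [F - PF] telescopes to
    [f - P^t f] for the ergodic sum [F]. *)
Lemma ergodic_sum_bound H f t x : 0 < H -> hitting_bound H ->
  \sum_x pi x * f x = 0 -> (forall y z, f y - f z <= 1) ->
  `|\sum_(s < t) iter s (avg P) f x| <= 2 * H.
Proof.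
move=> H0 hH f0 fosc.
apply: (potential_bound (F := fun x => \sum_(s < t) iter s (avg P) f x)) => //.
  under eq_bigr do rewrite big_distrr /=.
  rewrite exchange_big big1 //= => s _.
  by rewrite iter_avg_stationary.
move=> y; rewrite (avg_sum P t (fun s => iter s (avg P) f)) -sumrB /=.
have -> : \sum_(s < t) (iter s (avg P) f y - iter s.+1 (avg P) f y) =
    f y - iter t (avg P) f y.
  rewrite -(big_mkord xpredT
    (fun s => iter s (avg P) f y - iter s.+1 (avg P) f y)).
  under eq_bigr do rewrite -opprB.
  by rewrite sumrN telescope_sumr // opprB.
have := iter_avg_norm_le t y tP (f := fun z => f z - f y) (a := 1).
rewrite iter_avgBcst // distrC; apply=> z.
rewrite ler_norml; have := fosc z y; have := fosc y z.
by move=> *; apply/andP; split; lra.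
Qed.

Definition centred A x : R := ind A x - mass pi A.

Lemma centred_mean0 A : \sum_x pi x * centred A x = 0.
Proof.
have [_ pi1 _] := st.
under eq_bigr do rewrite mulrBr.
by rewrite sumrB -mass_ind -big_distrl /= pi1 mul1r subrr.
Qed.

Lemma centred_osc A x y : centred A x - centred A y <= 1.
Proof.
rewrite /centred /ind; case: (x \in A); case: (y \in A); rewrite /=; lra.
Qed.

Lemma iter_centred A s x :
  iter s (avg P) (centred A) x = mass (matpow P s x) A - mass pi A.
Proof. by rewrite mass_matpow iter_avgBcst. Qed.

Lemma cesaro_close H t A x : 0 < H -> hitting_bound H -> 8 * H <= t%:R ->
  `|t%:R^-1 * (\sum_(s < t) mass (matpow P s x) A) - mass pi A| <= 4^-1.
Proof.
move=> H0 hH Ht; have t0 : 0 < t%:R :> R by lra.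
have := ergodic_sum_bound t x H0 hH (centred_mean0 A) (centred_osc A).
have -> : \sum_(s < t) iter s (avg P) (centred A) x =
    t%:R * (t%:R^-1 * (\sum_(s < t) mass (matpow P s x) A) - mass pi A).
  under eq_bigr do rewrite iter_centred.
  rewrite sumrB sumr_const card_ord -[_ *+ t]mulr_natl mulrBr mulrA.
  by rewrite divff ?mul1r // lt0r_neq0.
rewrite normrM (gtr0_norm t0) => h.
rewrite -(ler_pM2l t0); lra.
Qed.

End ErgodicSums.

(** * Autocorrelations of lazy reversible chains *)

Section Reversible.
Context {R : realType} {Omega : finType}.
Variables (P : Omega -> Omega -> R) (pi : Omega -> R).
Hypotheses (tP : transition_matrix P) (st : stationary_distribution P pi).
Hypotheses (rev : reversible_chain P pi) (lazy : forall x, 2^-1 <= P x x).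
Implicit Types (A : {set Omega}) (f g : Omega -> R) (x y : Omega).

Definition inner f g : R := \sum_x pi x * (f x * g x).

Lemma innerC f g : inner f g = inner g f.
Proof. by apply: eq_bigr => x _; rewrite [f x * _]mulrC. Qed.

(** Reversibility means that the transition operator is self-adjoint. *)
Lemma inner_avg f g : inner (avg P f) g = inner f (avg P g).
Proof.
rewrite /inner /avg.
under eq_bigr do rewrite mulrA big_distrr big_distrl /=.
under [RHS]eq_bigr do rewrite mulrA big_distrr /=.
rewrite exchange_big /=; apply: eq_bigr => y _; apply: eq_bigr => x _.
by rewrite mulrA -rev; ring.
Qed.

Lemma inner_sqr_ge0 f : 0 <= inner f f.
Proof.
have [pi0 _ _] := st.
by rewrite sumr_ge0 // => x _; rewrite mulr_ge0 // -expr2 sqr_ge0.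
Qed.

(** For [a = -1] this is twice the Dirichlet form [<f, (I - P) f>], and for
    [a = 1] its counterpart for [I + P]. *)
Lemma dirichlet_form f a : a ^+ 2 = 1 ->
  \sum_x \sum_y pi x * P x y * (f x + a * f y) ^+ 2 =
  2 * (inner f f + a * inner f (avg P f)).
Proof.
move=> a2; have [_ P1] := tP; have [_ _ stP] := st.
have -> : 2 * (inner f f + a * inner f (avg P f)) =
   inner f f + \sum_x pi x * avg P (fun y => f y * f y) x
    + 2 * (a * inner f (avg P f)).
  by rewrite avg_stationary // -/(inner f f); lra.
rewrite /inner !big_distrr /= -!big_split /=.
apply: eq_bigr => x _; rewrite /avg.
transitivity (\sum_y (pi x * f x ^+ 2 * P x y + pi x * (P x y * (f y * f y)) +
   2 * (a * (pi x * (f x * (P x y * f y)))))).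
  by apply: eq_bigr => y _; rewrite sqrrD exprMn a2; ring.
rewrite !big_split /= -big_distrr /= P1 mulr1 !big_distrr /=.
by rewrite expr2.
Qed.

Lemma inner_avg_le f : inner f (avg P f) <= inner f f.
Proof.
have [P0 _] := tP; have [pi0 _ _] := st.
suff : 0 <= 2 * (inner f f + (-1) * inner f (avg P f)) by lra.
rewrite -dirichlet_form; last by rewrite sqrrN expr1n.
apply: sumr_ge0 => x _; apply: sumr_ge0 => y _.
by apply: mulr_ge0 (sqr_ge0 _); exact: mulr_ge0.
Qed.

(** Positivity of a lazy chain: in the sum of [(f x + f y)^2], the diagonal
    terms alone contribute at least [2 <f, f>], as they carry weight at least
    [1/2]; what remains is [2 <f, Pf>]. *)
Lemma inner_avg_ge0 f : 0 <= inner f (avg P f).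
Proof.
have [P0 _] := tP; have [pi0 _ _] := st.
suff : 2 * inner f f <= 2 * (inner f f + 1 * inner f (avg P f)) by lra.
rewrite -dirichlet_form ?expr1n // /inner big_distrr /=.
apply: ler_sum => x _; rewrite (bigD1 x) //= mul1r.
have h1 : 0 <= \sum_(y | y != x) pi x * P x y * (f x + 1 * f y) ^+ 2.
  by apply: sumr_ge0 => y _; apply: mulr_ge0 (sqr_ge0 _); exact: mulr_ge0.
have := ler_wpM2r (sqr_ge0 (f x)) (ler_wpM2l (pi0 x) (lazy x)).
have -> : (f x + f x) ^+ 2 = 4 * f x ^+ 2 by ring.
move=> h2.
have -> : 2 * (pi x * (f x * f x)) = 4 * (pi x * 2^-1 * f x ^+ 2) by lra.
have -> : pi x * P x x * (4 * f x ^+ 2) = 4 * (pi x * P x x * f x ^+ 2) by ring.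
lra.
Qed.

Definition autocorrelation f j : R := inner f (iter j (avg P) f).

Lemma inner_iter f i j :
  inner (iter i (avg P) f) (iter j (avg P) f) = autocorrelation f (i + j).
Proof.
elim: i j => [|i IH] j //.
by rewrite iterS inner_avg -iterS IH addSnnS.
Qed.

Lemma inner_subl f g h : inner (fun x => f x - g x) h = inner f h - inner g h.
Proof. by rewrite -sumrB; apply: eq_bigr => x _; ring. Qed.

Lemma inner_subr f g h : inner h (fun x => f x - g x) = inner h f - inner h g.
Proof. by rewrite ![inner h _]innerC inner_subl. Qed.

Lemma inner_increment f i j :
  inner (fun x => iter i (avg P) f x - iter i.+1 (avg P) f x)
        (fun x => iter j (avg P) f x - iter j.+1 (avg P) f x) =
  autocorrelation f (i + j) - 2 * autocorrelation f (i + j).+1 +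
  autocorrelation f (i + j).+2.
Proof.
by rewrite inner_subl !inner_subr !inner_iter !addSn !addnS; ring.
Qed.

(** With [g = P^k f], the terms of index [2k] and [2k + 1] are [<g, g>] and
    [<g, Pg>].  The same splitting by parity, with the increment
    [P^k f - P^(k+1) f] in place of [g], proves convexity. *)
Lemma autocorrelation_ge0 f j : 0 <= autocorrelation f j.
Proof.
rewrite -(odd_double_half j) -addnn; case: (odd j) => /=.
  by rewrite add1n -addnS -inner_iter inner_avg_ge0.
by rewrite add0n -inner_iter inner_sqr_ge0.
Qed.

Lemma autocorrelation_convex f j :
  autocorrelation f j.+1 - autocorrelation f j.+2 <=
  autocorrelation f j - autocorrelation f j.+1.
Proof.
suff : 0 <= autocorrelation f j - 2 * autocorrelation f j.+1 +
  autocorrelation f j.+2 by lra.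
rewrite -(odd_double_half j) -addnn; case: (odd j) => /=.
  rewrite add1n -addnS -inner_increment.
  set h := (X in inner X _).
  rewrite (_ : (fun x => _) = avg P h) ?inner_avg_ge0 //.
  by apply/funext => x; rewrite /h avgB.
by rewrite add0n -inner_increment inner_sqr_ge0.
Qed.

Lemma autocorrelation_decr f j :
  autocorrelation f j.+1 <= autocorrelation f j.
Proof.
have even_decr k : autocorrelation f (k + k).+1 <= autocorrelation f (k + k).
  by rewrite -addnS -!inner_iter inner_avg_le.
rewrite -(odd_double_half j) -addnn; case: (odd j) => /=; last by rewrite add0n.
rewrite add1n; have := autocorrelation_convex f (j./2 + j./2).+1.
by have := even_decr j./2.+1; rewrite addnS addSn; lra.
Qed.

End Reversible.

(** * Mixing of lazy reversible chains *)

Section SequenceBounds.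
Context {R : realType}.
Implicit Types (u : nat -> R).

Lemma antitone_mul_le_sum u n : (forall i, u i.+1 <= u i) ->
  n%:R * u n <= \sum_(i < n) u i.
Proof.
move=> du; elim: n => [|n IH]; first by rewrite mul0r big_ord0.
rewrite big_ord_recr /= -natr1 mulrDl mul1r.
by apply: lerD => //; apply: le_trans IH; rewrite ler_wpM2l.
Qed.

(** The Cauchy-Schwarz inequality; in the induction step the defect grows by
    the sum of the [(u i - u n)^2]. *)
Lemma sqr_sum_le u n : (\sum_(i < n) u i) ^+ 2 <= n%:R * \sum_(i < n) u i ^+ 2.
Proof.
elim: n => [|n IH]; first by rewrite big_ord0 expr0n mul0r.
rewrite !big_ord_recr /= -natr1.
have : 0 <= \sum_(i < n) (u i - u n) ^+ 2.
  by rewrite sumr_ge0 // => i _; exact: sqr_ge0.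
have -> : \sum_(i < n) (u i - u n) ^+ 2 = \sum_(i < n) u i ^+ 2
    - 2 * u n * (\sum_(i < n) u i) + n%:R * u n ^+ 2.
  transitivity (\sum_(i < n) (u i ^+ 2 - 2 * u n * u i + u n ^+ 2)).
    by apply: eq_bigr => i _; ring.
  rewrite big_split sumrB -big_distrr sumr_const card_ord.
  by rewrite [n%:R * _]mulr_natl.
nra.
Qed.

Lemma ex_natr_ceil (a : R) : 0 <= a -> exists n : nat, a <= n%:R <= a + 1.
Proof.
move=> a0; exists (Num.truncn a).+1.
have := truncn_le a; rewrite a0 => /= h.
by rewrite ltW ?truncnS_gt //= -natr1 lerD2r h.
Qed.

End SequenceBounds.

Section Mixing.
Context {R : realType} {Omega : finType}.
Variables (P : Omega -> Omega -> R) (pi : Omega -> R).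
Hypotheses (tP : transition_matrix P) (st : stationary_distribution P pi).
Hypotheses (rev : reversible_chain P pi) (lazy : forall x, 2^-1 <= P x x).
Implicit Types (A : {set Omega}) (f g : Omega -> R) (x y : Omega).

Lemma iter_telescope_norm f t N n x : (n <= N)%N ->
  `|iter (t + n) (avg P) f x| <= `|iter t (avg P) f x| +
    \sum_(j < N) `|iter (t + j) (avg P) f x - iter (t + j).+1 (avg P) f x|.
Proof.
move=> nN.
pose v (j : nat) := `|iter (t + j) (avg P) f x - iter (t + j).+1 (avg P) f x|.
apply: (@le_trans _ _ (`|iter t (avg P) f x| + \sum_(j < n) v j)).
  elim: n nN => [|n IH] nN; first by rewrite addn0 big_ord0 addr0.
  rewrite big_ord_recr /= addrA addnS.
  apply: le_trans (_ : _ <= `|iter (t + n) (avg P) f x| + v n) _.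
    rewrite /v; set p := iter (t + n) _ _ _; set q := iter _.+1 _ _ _.
    by rewrite distrC -[q in leLHS](subrK p) addrC ler_normD.
  by rewrite lerD2r IH // ltnW.
rewrite lerD2l -!(big_mkord xpredT v) (big_cat_nat (leq0n n) nN) /= lerDl.
by rewrite sumr_ge0 // => j _; exact: normr_ge0.
Qed.

(** The squared norm of [P^k f - P^(k+1) f] is the second difference of the
    autocorrelation at [2k], so the sum telescopes after convexity has been
    used to supply the missing odd second differences. *)
Lemma increments_energy_le f t N :
  \sum_(j < N) inner pi
     (fun x => iter (t + j) (avg P) f x - iter (t + j).+1 (avg P) f x)
     (fun x => iter (t + j) (avg P) f x - iter (t + j).+1 (avg P) f x) <=
  autocorrelation P pi f (t + t) - autocorrelation P pi f (t + t).+1.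
Proof.
pose c := autocorrelation P pi f.
pose b j := c j - c j.+1.
have b0 j : 0 <= b j by rewrite subr_ge0; exact: autocorrelation_decr.
suff h : \sum_(j < N) inner pi
     (fun x => iter (t + j) (avg P) f x - iter (t + j).+1 (avg P) f x)
     (fun x => iter (t + j) (avg P) f x - iter (t + j).+1 (avg P) f x) <=
     b (t + t)%N - b ((t + N) + (t + N))%N.
  by apply: le_trans h _; rewrite gerBl.
elim: N => [|N IH]; first by rewrite big_ord0 !addn0 subrr.
rewrite big_ord_recr /= inner_increment // -/c.
have := autocorrelation_convex tP st rev lazy f (t + N + (t + N)).+1.
by move: IH; rewrite -/c /b !addnS !addSn; lra.
Qed.

(** The quantity [Z] dominates [|P^(t+n) f|] for all [n <= N] at once; this
    elementary maximal inequality suffices because the increments over a window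
    of length comparable to [t] have small total energy.  The constants make
    [E_pi Z^2 <= (4H + 2N) / (2t)] at most [1/128], so that [Z <= 1/8] on a set
    of mass at least [1/2]. *)
Lemma mixing_close H t N A x : 0 < H -> hitting_bound P pi H ->
  8 * H <= N%:R -> 256 * H + 128 * N%:R <= t%:R ->
  `|mass (matpow P (t + N) x) A - mass pi A| <= 4^-1.
Proof.
move=> H0 hH HN Ht; have [pi0 pi1 _] := st.
rewrite -iter_centred //; set f := centred pi A.
have f1 y : `|f y| <= 1.
  have m0 : 0 <= mass pi A by rewrite sumr_ge0.
  have m1 : mass pi A <= 1.
    rewrite -pi1 mass_ind; apply: ler_sum => z _.
    by rewrite /ind; case: (z \in A); rewrite ?mulr1 ?mulr0.
  rewrite ler_norml /f /centred /ind; case: (y \in A); rewrite /=;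
    by apply/andP; split; lra.
pose c := autocorrelation P pi f.
have c0 j : 0 <= c j by exact: autocorrelation_ge0.
have cdec j : c j.+1 <= c j by exact: autocorrelation_decr.
have inner_le g a : (forall y, `|g y| <= a) -> inner pi f g <= a.
  move=> ga; rewrite -[a]mul1r -pi1 big_distrl /=; apply: ler_sum => y _.
  rewrite ler_wpM2l //; apply: le_trans (ler_norm _) _.
  rewrite normrM -[a]mul1r; exact: ler_pM.
(* The left side is at most [c_0 + ... + c_{n-1}], the scalar product of [f]
   with its ergodic sum. *)
have c_avg n : n%:R * c n <= 2 * H.
  apply: le_trans (antitone_mul_le_sum n cdec) _.
  rewrite /c /autocorrelation /inner exchange_big /=.
  under eq_bigr do rewrite -!big_distrr /=.
  apply: inner_le => y; apply: (ergodic_sum_bound tP st n y H0 hH).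
    exact: (centred_mean0 st A).
  exact: (centred_osc pi A).
pose b j := c j - c j.+1.
have bdec j : b j.+1 <= b j by exact: autocorrelation_convex.
have b_avg n : n%:R * b n <= 1.
  apply: le_trans (antitone_mul_le_sum n bdec) _.
  have -> : \sum_(i < n) b i = c 0%N - c n.
    elim: n => [|n IH]; first by rewrite big_ord0 subrr.
    by rewrite big_ord_recr /= IH /b; lra.
  have c01 : c 0%N <= 1 by exact: inner_le.
  by have := c0 n; lra.
pose h j y := iter (t + j) (avg P) f y - iter (t + j).+1 (avg P) f y.
pose Z y := `|iter t (avg P) f y| + \sum_(j < N) `|h j y|.
have Z0 y : 0 <= Z y by rewrite addr_ge0 // sumr_ge0.
have EZ : \sum_y pi y * Z y ^+ 2 <= 2 * c (t + t)%N + 2 * N%:R * b (t + t)%N.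
  apply: (@le_trans _ _ (2 * c (t + t)%N +
     2 * N%:R * \sum_(j < N) inner pi (h j) (h j))); last first.
    rewrite lerD2l; apply: ler_wpM2l; first by rewrite mulr_ge0.
    exact: increments_energy_le.
  rewrite /c -(inner_iter rev) /inner exchange_big !big_distrr /= -big_split /=.
  apply: ler_sum => y _.
  rewrite -big_distrr /=.
  have -> : \sum_(j < N) h j y * h j y = \sum_(j < N) `|h j y| ^+ 2.
    by apply: eq_bigr => j _; rewrite real_normK ?num_real // expr2.
  rewrite -expr2 -[iter t _ f y ^+ 2]real_normK ?num_real //.
  have := sqr_sum_le (fun j => `|h j y|) N.
  rewrite /Z; set a := `|iter _ _ _ _|.
  set s := \sum_(_ < _) _; set q := \sum_(_ < _) _.
  move=> CS.
  have -> : 2 * (pi y * a ^+ 2) + 2 * N%:R * (pi y * q) =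
    pi y * (2 * a ^+ 2 + 2 * (N%:R * q)) by ring.
  by rewrite ler_wpM2l //; have := sqr_ge0 (a - s); nra.
have t0 : 0 < (t + t)%:R :> R by rewrite natrD; lra.
have EZ_small : \sum_y pi y * Z y ^+ 2 <= 64^-1 / 2.
  apply: le_trans EZ _; rewrite -(ler_pM2l t0).
  have := c_avg (t + t)%N; have := b_avg (t + t)%N; rewrite natrD.
  have N0 : 0 <= N%:R :> R by [].
  move=> hb hc; have := ler_wpM2l N0 hb; lra.
pose G := [set y | Z y ^+ 2 <= 64^-1].
have hG : 2^-1 <= mass pi G.
  by apply: mass_sublevel => // y; exact: sqr_ge0.
have fG n y : (n <= N)%N -> y \in G -> `|iter (t + n) (avg P) f y| <= 8^-1.
  move=> nN; rewrite inE => Zy.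
  apply: le_trans (iter_telescope_norm f t y nN) _; rewrite -/(Z y).
  have := Z0 y; nra.
(* Markov property at the hitting time of [G], by induction on the number [n]
   of steps left: trajectories that reach [G] contribute at most [1/8], and the
   others at most their probability. *)
have key n : (n <= N)%N -> forall y,
    `|iter (t + n) (avg P) f y| <= 8^-1 + survival P G n.+1 y.
  elim: n => [|n IH] nN y; rewrite survivalE; case: ifP => yG;
    rewrite ?addr0; try exact: fG.
    rewrite avg_cst //; apply: (@le_trans _ _ 1); last by lra.
    exact: iter_avg_norm_le.
  rewrite addnS /= -[8^-1](avg_cst _ y tP) -avgD.
  apply: le_trans (avg_le y tP (IH (ltnW nN))).
  rewrite /avg; apply: le_trans (ler_norm_sum _ _ _) _.
  apply: ler_sum => z _; rewrite normrM ger0_norm //; exact: (proj1 tP).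
apply: le_trans (key N (leqnn N) x) _.
have N1 : 0 < N.+1%:R :> R by [].
suff : survival P G N.+1 x <= 8^-1 by lra.
have := survival_markov tP G N.+1 x; have := hH G hG N.+1 x.
move=> hitG markov; rewrite -(ler_pM2l N1); move: markov; rewrite -natr1; lra.
Qed.

End Mixing.

(** * The maximal hitting time as a real number *)

Section MaxHittingTime.
Context {R : realType} {Omega : finType}.
Variables (P : Omega -> Omega -> R) (pi : Omega -> R).
Hypotheses (tP : transition_matrix P) (st : stationary_distribution P pi).
Implicit Types (A : {set Omega}) (x y : Omega).

Lemma matpow_ge0 t x y : 0 <= matpow P t x y.
Proof.
elim: t x => [|t IH] x //=.
by rewrite sumr_ge0 // => z _; rewrite mulr_ge0 // (proj1 tP).
Qed.

(** Irreducibility makes [A] reachable from each state; a common time and a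
    common gap exist because the state space is finite. *)
Lemma survival_uniform_lt1 A y : irreducible_chain P -> y \in A ->
  exists t e, 0 < e /\ forall x, survival P A t x <= 1 - e.
Proof.
move=> irr yA.
have /choice[t ht] x : exists t, survival P A t x < 1.
  have [t ht] := irr x y; exists t.+1.
  apply: le_lt_trans (survival_le_avoid tP A t x) _.
  rewrite -mass_matpow ltrBlDr ltrDl /mass (bigD1 y) //=.
  by rewrite ltr_wpDr // sumr_ge0 // => z _; exact: matpow_ge0.
pose t' := (\max_x t x)%N.
have lt1 x : survival P A t' x < 1.
  by apply: le_lt_trans (survival_le tP A x _) (ht x); exact: leq_bigmax.
have [z zmax] := ex_maximizer (survival P A t') y.
exists t', (1 - survival P A t' z); rewrite subr_gt0; split => // x.
by rewrite opprB addrC subrK.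
Qed.

Lemma ex_half_mass_missing : (1 < #|Omega|)%N ->
  exists A x, x \notin A /\ 2^-1 <= mass pi A.
Proof.
move=> /card_gt1P[x [y [_ _ xy]]]; have [_ pi1 _] := st.
have [h|h] := leP (mass pi [set x]) 2^-1.
  exists (~: [set x]), x; split; first by rewrite !inE negbK.
  by have := mass_le_setC pi1 h; lra.
by exists [set x], y; rewrite inE eq_sym; split => //; exact: ltW.
Qed.

Context {d : measure_display} {T : measurableType d}.
Variables (Pr : Omega -> probability T R) (X : nat -> T -> Omega).
Hypothesis mc : markov_chain P Pr X.

(** Finiteness comes from irreducibility.  The lower bound 1 holds because some
    set of mass at least [1/2] misses a state; it absorbs the rounding of real
    times to integers. *)
Lemma max_hitting_time_real : (1 < #|Omega|)%N -> irreducible_chain P ->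
  exists H : R, [/\ max_hitting_time Pr X pi 2^-1 = H%:E, 1 <= H,
    hitting_bound P pi H &
    forall M, hitting_bound P pi M -> H <= M].
Proof.
move=> card2 irr; set m := max_hitting_time _ _ _ _.
have le_m A x : 2^-1 <= mass pi A -> (expected_hitting_time Pr X x A <= m)%E.
  by move=> hA; exact: (bigmax_sup (x, A)).
have m_lt : (m < +oo)%E.
  rewrite /m /max_hitting_time; apply: bigmax_lt => //.
  move=> [x A] /= hA.
  have [y yA] : exists y, y \in A.
    apply/finset.set0Pn/eqP => A0; move: hA; rewrite A0 /mass big_set0; lra.
  have [t [e [e0 he]]] := survival_uniform_lt1 irr yA.
  apply: le_lt_trans (ltry (t%:R / e)).
  by apply: (expected_le_truncated_hit tP mc); exact: truncated_hit_bounded.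
have m_ge1 : (1%:E <= m)%E.
  have [A [x [xA hA]]] := ex_half_mass_missing card2.
  apply: le_trans (le_m A x hA).
  have := truncated_hit_le_expected tP mc x A 1.
  by rewrite /= (negbTE xA) avg_cst // addr0.
have m_fin : m \is a fin_num.
  by rewrite fin_numElt m_lt andbT (lt_le_trans _ m_ge1) // ltNyr.
exists (fine m); rewrite fineK //; split => //.
- by rewrite -lee_fin fineK.
- move=> A hA n x; rewrite -lee_fin fineK //.
  by apply: le_trans (truncated_hit_le_expected tP mc x A n) _; exact: le_m.
- move=> M hM; rewrite -lee_fin fineK //.
  apply: bigmax_le; first exact: leNye.
  move=> [x A] /= hA.
  by apply: (expected_le_truncated_hit tP mc) => n; exact: hM.
Qed.

End MaxHittingTime.

(** * Hitting times from mixing times *)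

Section MixingUpperBounds.
Context {R : realType} {Omega : finType}.
Variables (P : Omega -> Omega -> R) (pi : Omega -> R).
Hypothesis tP : transition_matrix P.
Implicit Types (A : {set Omega}) (x y : Omega).

Lemma hitting_bound_mixing t : (0 < t)%N ->
  (forall x A, `|mass (matpow P t x) A - mass pi A| <= 4^-1) ->
  hitting_bound P pi (8 * t%:R).
Proof.
move=> t0 ht A hA n x.
apply: (@le_trans _ _ (t.+1%:R / 4^-1)).
  apply: truncated_hit_bounded => // y.
  have := survival_le_avoid tP A t y; rewrite -mass_matpow.
  by have := ht y A; rewrite ler_norml => /andP[*]; lra.
have : 1 <= t%:R :> R by rewrite ler1n.
by rewrite invrK -natr1; lra.
Qed.

Lemma hitting_bound_cesaro t : (0 < t)%N ->
  (forall x A,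
    `|t%:R^-1 * (\sum_(s < t) mass (matpow P s x) A) - mass pi A| <= 4^-1) ->
  hitting_bound P pi (4 * t%:R).
Proof.
move=> t0 ht A hA n x; have t0R : 0 < t%:R :> R by rewrite ltr0n.
rewrite mulrC -[4]invrK; apply: truncated_hit_bounded => // y.
rewrite -(ler_pM2l t0R).
have : t%:R * survival P A t y <= \sum_(s < t) (1 - mass (matpow P s y) A).
  rewrite mulr_natl -[X in _ *+ X]card_ord -sumr_const; apply: ler_sum => s _.
  rewrite mass_matpow; apply: le_trans (survival_le_avoid tP A s y).
  exact: survival_le.
rewrite sumrB sumr_const card_ord.
move: (ht y A); rewrite ler_norml => /andP[h _].
have : 4^-1 <= t%:R^-1 * (\sum_(s < t) mass (matpow P s y) A) by lra.
rewrite -(ler_pM2l t0R) mulrA divff ?lt0r_neq0 // mul1r; lra.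
Qed.

End MixingUpperBounds.

Lemma nat_min_spec (S : set nat) t : S t -> S (nat_min S) /\ (nat_min S <= t)%N.
Proof.
move=> St.
have exS : exists n, `[< S n >] by exists t; apply/asboolP.
case: (ex_minnP exS) => k /asboolP Sk kmin.
rewrite /nat_min; case: xgetP => [m _ [Sm m_min]|/(_ k) []].
  by split => //; exact: m_min.
by split => // s Ss; apply: kmin; apply/asboolP.
Qed.

Lemma mixing_time_spec (R : realType) (Omega : finType)
    (P : Omega -> Omega -> R) (pi : Omega -> R) t : (0 < t)%N ->
  (forall x A, `|mass (matpow P t x) A - mass pi A| <= 4^-1) ->
  [/\ (0 < mixing_time P pi)%N, (mixing_time P pi <= t)%N &
    forall x A,
      `|mass (matpow P (mixing_time P pi) x) A - mass pi A| <= 4^-1].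
Proof.
move=> t0 ht; rewrite /mixing_time; set S := [set t | _]%classic.
by have [[]] : S (nat_min S) /\ (nat_min S <= t)%N by exact: nat_min_spec.
Qed.

Lemma cesaro_mixing_time_spec (R : realType) (Omega : finType)
    (P : Omega -> Omega -> R) (pi : Omega -> R) t : (0 < t)%N ->
  (forall x A,
    `|t%:R^-1 * (\sum_(s < t) mass (matpow P s x) A) - mass pi A| <= 4^-1) ->
  let t' := cesaro_mixing_time P pi in
  [/\ (0 < t')%N, (t' <= t)%N & forall x A,
    `|t'%:R^-1 * (\sum_(s < t') mass (matpow P s x) A) - mass pi A| <= 4^-1].
Proof.
move=> t0 ht; rewrite /cesaro_mixing_time; set S := [set t | _]%classic.
by have [[]] : S (nat_min S) /\ (nat_min S <= t)%N by exact: nat_min_spec.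
Qed.

Theorem theorem1p9 (R : realType) :
  exists c : R, 0 < c /\
    (forall (Omega : finType) (P : Omega -> Omega -> R) (pi : Omega -> R)
        (d : measure_display) (T : measurableType d)
        (Pr : Omega -> probability T R) (X : nat -> T -> Omega),
      (1 < #|Omega|)%N ->
      transition_matrix P ->
      irreducible_chain P ->
      stationary_distribution P pi ->
      markov_chain P Pr X ->
      reversible_chain P pi ->
      (forall x, 2^-1 <= P x x) ->
      (((mixing_time P pi)%:R / c)%:E <= max_hitting_time Pr X pi 2^-1)%E /\
      (max_hitting_time Pr X pi 2^-1 <= (c * (mixing_time P pi)%:R)%:E)%E) /\
    (forall (Omega : finType) (P : Omega -> Omega -> R) (pi : Omega -> R)
        (d : measure_display) (T : measurableType d)
        (Pr : Omega -> probability T R) (X : nat -> T -> Omega),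
      (1 < #|Omega|)%N ->
      transition_matrix P ->
      irreducible_chain P ->
      stationary_distribution P pi ->
      markov_chain P Pr X ->
      (((cesaro_mixing_time P pi)%:R / c)%:E
         <= max_hitting_time Pr X pi 2^-1)%E /\
      (max_hitting_time Pr X pi 2^-1
         <= (c * (cesaro_mixing_time P pi)%:R)%:E)%E).
Proof.
(* An opaque [c]: conversion must not unfold the numeral 1500. *)
have [c [cE c0]] : exists c : R, c = 1500 /\ 0 < c.
  by exists 1500; rewrite ltr0n.
exists c; split; first exact: c0.
split => Omega P pi d T Pr X card2 tP irr st mc.
- move=> rev lazy.
  have [H [-> H1 hH Hmin]] := max_hitting_time_real tP st mc card2 irr.
  have H0 : 0 < H by lra.
  (* Then [t + N <= 256 H + 129 (8 H + 1) + 1 <= 1500 H], using [1 <= H]. *)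
  have [N /andP[N1 N2]] : exists N : nat, 8 * H <= N%:R <= 8 * H + 1.
    by apply: ex_natr_ceil; lra.
  have [t /andP[t1 t2]] : exists t : nat,
      256 * H + 128 * N%:R <= t%:R <= 256 * H + 128 * N%:R + 1.
    by apply: ex_natr_ceil; lra.
  have tN0 : (0 < t + N)%N by rewrite -(ltr0n R) natrD; lra.
  have [mix0 mix_le mix] := mixing_time_spec tN0
    (fun x A => mixing_close tP st rev lazy A x H0 hH N1 t1).
  rewrite !lee_fin; split.
    have : (mixing_time P pi)%:R <= (t + N)%:R :> R by rewrite ler_nat.
    by rewrite (ler_pdivrMr _ _ c0) cE natrD; lra.
  apply: le_trans (Hmin _ (hitting_bound_mixing tP mix0 mix)) _.
  by apply: ler_wpM2r; [exact: ler0n|rewrite cE; lra].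
- have [H [-> H1 hH Hmin]] := max_hitting_time_real tP st mc card2 irr.
  have H0 : 0 < H by lra.
  have [t /andP[t1 t2]] : exists t : nat, 8 * H <= t%:R <= 8 * H + 1.
    by apply: ex_natr_ceil; lra.
  have t0 : (0 < t)%N by rewrite -(ltr0n R); lra.
  have [ces0 ces_le ces] := cesaro_mixing_time_spec t0
    (fun x A => cesaro_close tP st A x H0 hH t1).
  rewrite !lee_fin; split.
    have : (cesaro_mixing_time P pi)%:R <= t%:R :> R by rewrite ler_nat.
    by rewrite (ler_pdivrMr _ _ c0) cE; lra.
  apply: le_trans (Hmin _ (hitting_bound_cesaro tP ces0 ces)) _.
  by apply: ler_wpM2r; [exact: ler0n|rewrite cE; lra].
Qed.
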